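(* There exist an $\varepsilon_0>0$ and holomorphic functions $z^-,z^0,z^+:B'(\varepsilon_0)\to\mathbb C$, written $\varepsilon\mapsto z^\bullet_\varepsilon$, such that $$f_\varepsilon(z^-_\varepsilon)=f_\varepsilon(z^0_\varepsilon)=f_\varepsilon(z^+_\varepsilon)=0\qquad\text{for all }\varepsilon\in B'(\varepsilon_0),$$ which are real-valued for $\varepsilon\in B'(\varepsilon_0)\cap(0,\infty)$ and satisfy $$z^-_\varepsilon<z^0_\varepsilon<z^+_\varepsilon\qquad\text{for }\varepsilon\in B'(\varepsilon_0)\cap(0,\infty).$$ The leading parts of their Laurent series around $\varepsilon=0$ are $$z^0_\varepsilon=\frac{1+\alpha}{3}+\mathcal O(\varepsilon^2),\qquad z^\pm_\varepsilon=\pm\sqrt3\,\varepsilon^{-1}+\frac{1+\alpha}{3}+\mathcal O(\varepsilon).$$ In particular, the expansion of $z^0_\varepsilon$ has no linear contribution in $\varepsilon$.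
   Context: Fix $\alpha\in(0,1/2)$. For $\varepsilon\in\mathbb C\setminus\{0\}$ let $$f_\varepsilon(u)=-u^3+(1+\alpha)u^2+(3\varepsilon^{-2}-\alpha)u-(1+\alpha)\varepsilon^{-2}.$$ For $r>0$, $B'(r)=\{z\in\mathbb C:0<|z|<r\}$ denotes the punctured open ball. *)

(* Defs.v *)
From Stdlib Require Import Reals ZArith.
From Coquelicot Require Import Coquelicot.
Open Scope R_scope.

Definition punctured_ball (r : R) (z : C) : Prop := 0 < Cmod z < r.

Definition f_cubic (alpha : R) (eps u : C) : C :=
  (- u ^ 3 + (1 + alpha) * u ^ 2 + (3 * / eps ^ 2 - alpha) * u
   - (1 + alpha) * / eps ^ 2)%C.

(* Complex differentiability: the scalar field is [C_AbsRing], so the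
   differential is C-linear.  Meant for open [D], [g] being total but
   arbitrary outside [D]. *)
Definition holomorphic_on (D : C -> Prop) (g : C -> C) : Prop :=
  forall z : C, D z -> @ex_derive C_AbsRing C_NormedModule g z.

(* The two-sided series sum_{n in Z} c_n z^n converges to l: the parts
   n >= 0 and n <= -1 converge separately. *)
Definition is_laurent_sum (c : Z -> C) (z l : C) : Prop :=
  exists lreg lprin : C,
    @is_series C_AbsRing C_NormedModule
      (fun n : nat => (c (Z.of_nat n) * z ^ n)%C) lreg /\
    @is_series C_AbsRing C_NormedModule
      (fun n : nat => (c (- Z.of_nat (S n))%Z * / z ^ (S n))%C) lprin /\
    l = (lreg + lprin)%C.

Definition laurent_expansion (r : R) (g : C -> C) (c : Z -> C) : Prop :=
  forall z : C, punctured_ball r z -> is_laurent_sum c z (g z).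

(* h(eps) = O(eps^k) as eps -> 0, eps in C \ {0} *)
Definition bigO_pow (k : nat) (h : C -> C) : Prop :=
  exists (M delta : R), 0 < delta /\
    forall eps : C, punctured_ball delta eps ->
      Cmod (h eps) <= M * Cmod eps ^ k.

(* Main.v *)
Require Import Defs.
From Stdlib Require Import Reals ZArith Lra Lia.
From Coquelicot Require Import Coquelicot.
Open Scope R_scope.

(** The substitution [w = eps * u] removes the pole of the coefficients:
    [f_cubic alpha eps u = 0] becomes
    [- w^3 + (1 + alpha) eps w^2 + 3 w - alpha eps^2 w - (1 + alpha) eps = 0],
    whose coefficients are polynomial in [eps] and which at [eps = 0] reduces
    to [3 w = w^3].  The three roots [s] of the latter, [0] and [+- sqrt 3],
    are simple, so each of them continues to an analytic branch
    [w = s + v(eps)] with [v(0) = 0], and [u = s / eps + v(eps) / eps] is the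
    wanted root.

    Writing [d = 3 - 3 s^2 <> 0] and solving for the linear term, [v] satisfies
    a fixed-point equation [v = c0 + v (c1 + v (c2 + v c3))] in which the [ci]
    are polynomials in [eps], and [c0], [c1] vanish at [eps = 0].  It is solved
    by iteration on formal power series with real coefficients: each step
    fixes one more coefficient ([cubic_step_gain]), and a small ball of the
    weighted norm [sum |a_n| rho^n] is preserved ([cubic_fix_wnorm]), so the
    limit is a genuine power series on the disc of radius [rho].  Since this
    norm is submultiplicative and Cauchy products of absolutely convergent
    complex series converge to the product, the formal identity is an identity
    of functions ([cubic_fix_CPSeries]).

    Everything asked for is then read off the series ([cubic_branch]).  It
    is holomorphic because the second-order Taylor remainder of [z^n] is
    bounded by [rho^n] up to a factor independent of [n]
    ([Cpow_taylor_remainder]).  It is real on the reals because its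
    coefficients are real.  The first coefficient of [v] is
    [(1 + alpha) / 3] for every [s], and the second one is a multiple of [s],
    hence zero on the middle branch.  The order on the positive axis is that
    of the polar parts [s / eps], which dominate the bounded regular parts. *)

(** * A weighted norm on formal power series *)


(** The bound [sum |a_n| rho^n <= K], phrased through partial sums so that it
    asserts convergence at the same time. *)
Definition wnorm_le (rho : R) (a : nat -> R) (K : R) : Prop :=
  forall N : nat, sum_f_R0 (fun n => Rabs (a n) * rho ^ n) N <= K.

Lemma wterm_pos rho a n : 0 <= rho -> 0 <= Rabs (a n) * rho ^ n.
Proof.
  intros H; apply Rmult_le_pos; [apply Rabs_pos | now apply pow_le].
Qed.

Lemma wnorm_le_0 rho K : 0 <= K -> wnorm_le rho (fun _ => 0) K.
Proof.
  intros HK N; rewrite (sum_eq _ (fun _ => 0)).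
  - rewrite sum_cte; lra.
  - intros; rewrite Rabs_R0; ring.
Qed.

Lemma wnorm_le_plus rho a b K L : 0 <= rho ->
  wnorm_le rho a K -> wnorm_le rho b L ->
  wnorm_le rho (PS_plus a b) (K + L).
Proof.
  intros Hr Ha Hb N.
  apply Rle_trans with (sum_f_R0 (fun n => Rabs (a n) * rho ^ n) N
                        + sum_f_R0 (fun n => Rabs (b n) * rho ^ n) N);
    [| now apply Rplus_le_compat].
  rewrite <- plus_sum; apply sum_Rle; intros n _.
  rewrite <- Rmult_plus_distr_r; apply Rmult_le_compat_r.
  - now apply pow_le.
  - apply Rabs_triang.
Qed.

(** Summing the antidiagonals of the triangle [k + l <= N] amounts to summing
    its columns. *)
Lemma cauchy_partial_sums (u v : nat -> R) (N : nat) :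
  sum_f_R0 (PS_mult u v) N
  = sum_f_R0 (fun k => u k * sum_f_R0 v (N - k)) N.
Proof.
  induction N as [|N IH]; [reflexivity|].
  rewrite tech5, IH, (tech5 _ N).
  unfold PS_mult at 1; rewrite tech5, <- Rplus_assoc, <- plus_sum.
  rewrite Nat.sub_diag; f_equal.
  apply sum_eq; intros k Hk.
  replace (S N - k)%nat with (S (N - k)) by lia.
  rewrite (tech5 v); ring.
Qed.

(** The triangle of indices below an antidiagonal lies in a square, so a
    partial sum of the product is at most the product of partial sums. *)
Lemma wnorm_le_mult rho a b K L : 0 <= rho -> 0 <= L ->
  wnorm_le rho a K -> wnorm_le rho b L ->
  wnorm_le rho (PS_mult a b) (K * L).
Proof.
  intros Hr HL Ha Hb N.
  set (u := fun n => Rabs (a n) * rho ^ n).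
  set (v := fun n => Rabs (b n) * rho ^ n).
  apply Rle_trans with (sum_f_R0 (PS_mult u v) N).
  - apply sum_Rle; intros n _.
    unfold PS_mult.
    rewrite Rmult_comm.
    eapply Rle_trans.
    { apply Rmult_le_compat_l; [now apply pow_le | apply Rsum_abs]. }
    rewrite scal_sum; apply Req_le, sum_eq; intros k Hk.
    unfold u, v; rewrite Rabs_mult.
    replace n with (k + (n - k))%nat at 2 by lia.
    rewrite pow_add; ring.
  - rewrite cauchy_partial_sums.
    apply Rle_trans with (sum_f_R0 (fun k => u k * L) N).
    + apply sum_Rle; intros k _; apply Rmult_le_compat_l; [now apply wterm_pos | apply Hb].
    + rewrite <- (scal_sum u N L), Rmult_comm.
      now apply Rmult_le_compat_r.
Qed.

Lemma wnorm_le_shrink rho a K : 0 <= rho <= 1 ->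
  wnorm_le 1 a K -> wnorm_le rho a K.
Proof.
  intros Hr Ha N; eapply Rle_trans; [| apply (Ha N)].
  apply sum_Rle; intros n _; apply Rmult_le_compat_l; [apply Rabs_pos|].
  apply pow_incr; lra.
Qed.

(** Without constant term every weight contains a factor [rho]; this is what
    makes the coefficients [c0] and [c1] small on small discs. *)
Lemma wnorm_le_shrink_0 rho a K : 0 <= rho <= 1 -> a 0%nat = 0 ->
  wnorm_le 1 a K -> wnorm_le rho a (rho * K).
Proof.
  intros Hr H0 Ha N.
  eapply Rle_trans; [| apply Rmult_le_compat_l; [apply Hr | apply (Ha N)]].
  rewrite scal_sum; apply sum_Rle; intros [|n] _.
  - rewrite H0, Rabs_R0; lra.
  - rewrite pow1, Rmult_1_r; apply Rmult_le_compat_l; [apply Rabs_pos|].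
    assert (rho ^ n <= 1) by (rewrite <- (pow1 n); apply pow_incr; lra).
    simpl; nra.
Qed.

(** * Formal solution of a cubic fixed-point equation *)

Definition agree (n : nat) (a b : nat -> R) : Prop :=
  forall k : nat, (k <= n)%nat -> a k = b k.

Lemma agree_plus n a b c d :
  agree n a b -> agree n c d -> agree n (PS_plus a c) (PS_plus b d).
Proof.
  intros H1 H2 k Hk; unfold PS_plus.
  now rewrite (H1 k Hk), (H2 k Hk).
Qed.

Lemma agree_mult n a b c d :
  agree n a b -> agree n c d -> agree n (PS_mult a c) (PS_mult b d).
Proof.
  intros H1 H2 k Hk; apply sum_eq; intros i Hi.
  rewrite (H1 i), (H2 (k - i)%nat); [reflexivity | lia | lia].
Qed.

(** With both constant terms zero, the coefficient of index [n + 1] of a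
    product involves the factors only up to index [n]. *)
Lemma agree_mult_gain n a b c d :
  a 0%nat = 0 -> c 0%nat = 0 ->
  agree n a b -> agree n c d -> agree (S n) (PS_mult a c) (PS_mult b d).
Proof.
  intros Ha Hc H1 H2 k Hk; apply sum_eq; intros i Hi.
  assert (Hb : b 0%nat = 0) by (rewrite <- (H1 0%nat); [exact Ha | lia]).
  assert (Hd : d 0%nat = 0) by (rewrite <- (H2 0%nat); [exact Hc | lia]).
  destruct (Nat.eq_dec i 0) as [->|Hi0].
  { rewrite Ha, Hb; ring. }
  destruct (Nat.eq_dec i (S n)) as [->|HiS].
  { replace (k - S n)%nat with 0%nat by lia; rewrite Hc, Hd; ring. }
  rewrite (H1 i), (H2 (k - i)%nat); [reflexivity | lia | lia].
Qed.

Definition cubic_step (c0 c1 c2 c3 : nat -> R) (a : nat -> R) : nat -> R :=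
  PS_plus c0 (PS_mult a (PS_plus c1 (PS_mult a (PS_plus c2 (PS_mult a c3))))).

Lemma cubic_step_0 c0 c1 c2 c3 a :
  c0 0%nat = 0 -> a 0%nat = 0 -> cubic_step c0 c1 c2 c3 a 0%nat = 0.
Proof.
  intros h0 Ha; unfold cubic_step, PS_plus, PS_mult, plus; simpl; unfold plus; simpl.
  rewrite h0, Ha; ring.
Qed.

(** Contraction for the [X]-adic distance: the two sides are
    [c0 + a * h(a)] where [a] and [h(a)] both lack a constant term. *)
Lemma cubic_step_gain c0 c1 c2 c3 n a b : c1 0%nat = 0 -> a 0%nat = 0 ->
  agree n a b ->
  agree (S n) (cubic_step c0 c1 c2 c3 a) (cubic_step c0 c1 c2 c3 b).
Proof.
  intros h1 Ha H.
  apply agree_plus; [easy|].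
  apply agree_mult_gain; [exact Ha | | exact H |].
  - unfold PS_plus, PS_mult, plus; simpl; unfold plus; simpl.
    rewrite h1, Ha; ring.
  - apply agree_plus; [easy|]; apply agree_mult; [exact H|].
    apply agree_plus; [easy|]; now apply agree_mult.
Qed.

Fixpoint cubic_iter (c0 c1 c2 c3 : nat -> R) (k : nat) : nat -> R :=
  match k with
  | O => fun _ => 0
  | S k => cubic_step c0 c1 c2 c3 (cubic_iter c0 c1 c2 c3 k)
  end.

(** The diagonal is the [X]-adic limit of the iterates, since the coefficient
    of index [n] no longer changes after step [n]. *)
Definition cubic_fix (c0 c1 c2 c3 : nat -> R) (n : nat) : R :=
  cubic_iter c0 c1 c2 c3 n n.

Lemma cubic_iter_0 c0 c1 c2 c3 k :
  c0 0%nat = 0 -> cubic_iter c0 c1 c2 c3 k 0%nat = 0.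
Proof.
  intros h0; induction k as [|k IH]; [reflexivity | now apply cubic_step_0].
Qed.

Lemma cubic_iter_stable c0 c1 c2 c3 k : c0 0%nat = 0 -> c1 0%nat = 0 ->
  agree k (cubic_iter c0 c1 c2 c3 k) (cubic_iter c0 c1 c2 c3 (S k)).
Proof.
  intros h0 h1; induction k as [|k IH].
  - intros j Hj; replace j with 0%nat by lia; now rewrite !cubic_iter_0.
  - apply cubic_step_gain; [exact h1 | now apply cubic_iter_0 | exact IH].
Qed.

Lemma cubic_fix_agree c0 c1 c2 c3 k : c0 0%nat = 0 -> c1 0%nat = 0 ->
  agree k (cubic_fix c0 c1 c2 c3) (cubic_iter c0 c1 c2 c3 k).
Proof.
  intros h0 h1; induction k as [|k IH]; intros j Hj.
  - now replace j with 0%nat by lia.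
  - destruct (Nat.eq_dec j (S k)) as [->|Hne]; [reflexivity|].
    rewrite (IH j) by lia; apply cubic_iter_stable; [exact h0 | exact h1 | lia].
Qed.

Lemma cubic_fix_eq c0 c1 c2 c3 n : c0 0%nat = 0 -> c1 0%nat = 0 ->
  cubic_fix c0 c1 c2 c3 n = cubic_step c0 c1 c2 c3 (cubic_fix c0 c1 c2 c3) n.
Proof.
  intros h0 h1.
  assert (H := cubic_fix_agree c0 c1 c2 c3 n h0 h1).
  rewrite (cubic_step_gain c0 c1 c2 c3 n _ _ h1 eq_refl H n) by lia.
  rewrite (H n) by lia.
  apply cubic_iter_stable; [exact h0 | exact h1 | lia].
Qed.

(** Each iterate stays in the ball of radius [eta = 1 / (4 K)] for the norm
    at [rho = 1 / (16 K^2)].  By the choice of [rho], [c0] takes up a quarter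
    of [eta]; as [eta K = 1/4], the remaining terms leave room to spare. *)
Lemma cubic_fix_wnorm c0 c1 c2 c3 K : c0 0%nat = 0 -> c1 0%nat = 0 -> 1 <= K ->
  wnorm_le 1 c0 K -> wnorm_le 1 c1 K -> wnorm_le 1 c2 K -> wnorm_le 1 c3 K ->
  wnorm_le (/ (16 * K ^ 2)) (cubic_fix c0 c1 c2 c3) (/ (4 * K)).
Proof.
  intros h0 h1 HK HA HB HC HD.
  set (rho := / (16 * K ^ 2)); set (eta := / (4 * K)).
  assert (HK2 : 1 <= K ^ 2) by nra.
  assert (Hrho : 0 < rho <= 1).
  { unfold rho; split; [apply Rinv_0_lt_compat; lra|].
    rewrite <- Rinv_1; apply Rinv_le_contravar; lra. }
  assert (Heta : 0 < eta <= / 4).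
  { unfold eta; split; [apply Rinv_0_lt_compat; lra|].
    apply Rinv_le_contravar; lra. }
  assert (Heq : rho * K = eta / 4) by (unfold rho, eta; field; lra).
  assert (HeK : eta * K = / 4) by (unfold eta; field; lra).
  assert (Hit : forall k, wnorm_le rho (cubic_iter c0 c1 c2 c3 k) eta).
  { induction k as [|k IH]; [apply wnorm_le_0; lra|].
    (* [c0] and [c1] have norm at most [rho * K], [c2] and [c3] at most [K]. *)
    assert (H : wnorm_le rho (cubic_iter c0 c1 c2 c3 (S k))
        (rho * K + eta * (rho * K + eta * (K + eta * K)))).
    { unfold cubic_iter; fold cubic_iter; unfold cubic_step.
      repeat first [ apply wnorm_le_plus; [lra | |]
                   | apply wnorm_le_mult; [lra | | exact IH |] ].
      all: try (apply wnorm_le_shrink_0; [lra | assumption | assumption]).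
      all: try (apply wnorm_le_shrink; [lra | assumption]).
      all: try rewrite Heq; rewrite ?HeK; nra. }
    intros N; eapply Rle_trans; [apply H|].
    rewrite Heq, HeK; nra. }
  intros N; eapply Rle_trans; [| apply (Hit N N)].
  apply Req_le, sum_eq; intros n Hn.
  now rewrite (cubic_fix_agree c0 c1 c2 c3 N h0 h1 n Hn).
Qed.

(** * Absolutely convergent complex series *)

Notation is_Cseries u l := (@is_series C_AbsRing C_NormedModule u l).

Lemma Re_sum_n (u : nat -> C) N :
  Re (@sum_n C_NormedModule u N) = sum_n (fun n => Re (u n)) N.
Proof.
  induction N as [|N IH]; [now rewrite !sum_O|].
  rewrite !sum_Sn, <- IH; reflexivity.
Qed.

Lemma Im_sum_n (u : nat -> C) N :
  Im (@sum_n C_NormedModule u N) = sum_n (fun n => Im (u n)) N.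
Proof.
  induction N as [|N IH]; [now rewrite !sum_O|].
  rewrite !sum_Sn, <- IH; reflexivity.
Qed.

Lemma is_Cseries_parts (u : nat -> C) (l : C) :
  is_Cseries u l <->
  is_series (fun n => Re (u n)) (Re l) /\ is_series (fun n => Im (u n)) (Im l).
Proof.
  unfold is_series; split.
  - intros H; split.
    + apply filterlim_locally; intros eps.
      generalize (proj1 (filterlim_locally _ _) H eps); apply filter_imp.
      intros N [HN _]; rewrite <- Re_sum_n; exact HN.
    + apply filterlim_locally; intros eps.
      generalize (proj1 (filterlim_locally _ _) H eps); apply filter_imp.
      intros N [_ HN]; rewrite <- Im_sum_n; exact HN.
  - intros [H1 H2]; apply (filterlim_locally (U := C_NormedModule)); intros eps.
    generalize (filter_and _ _ (proj1 (filterlim_locally _ _) H1 eps)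
                               (proj1 (filterlim_locally _ _) H2 eps)).
    apply filter_imp; intros N [HN1 HN2].
    rewrite <- Re_sum_n in HN1; rewrite <- Im_sum_n in HN2.
    split; assumption.
Qed.

Definition CSeries (u : nat -> C) : C :=
  (Series (fun n => Re (u n)), Series (fun n => Im (u n))).

Lemma ex_series_nonneg_bounded (t : nat -> R) (M : R) :
  (forall n, 0 <= t n) -> (forall N, sum_f_R0 t N <= M) -> ex_series t.
Proof.
  intros Hpos HM.
  destruct (ex_finite_lim_seq_incr (sum_n t) M) as [l Hl].
  - intros n; rewrite sum_Sn; unfold plus; simpl; specialize (Hpos (S n)); lra.
  - intros n; rewrite sum_n_Reals; apply HM.
  - exists l; exact Hl.
Qed.

Lemma im_le_Cmod (z : C) : Rabs (Im z) <= Cmod z.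
Proof. eapply Rle_trans; [apply Rmax_r | apply Rmax_Cmod]. Qed.

Lemma Cmod_sum_n_le (u : nat -> C) N :
  Cmod (@sum_n C_NormedModule u N) <= sum_f_R0 (fun n => Cmod (u n)) N.
Proof.
  induction N as [|N IH]; [rewrite sum_O; apply Rle_refl|].
  rewrite sum_Sn, tech5; eapply Rle_trans; [apply Cmod_triangle|].
  now apply Rplus_le_compat_r.
Qed.

Lemma ex_series_Re_Im_abs (u : nat -> C) (M : R) :
  (forall N, sum_f_R0 (fun n => Cmod (u n)) N <= M) ->
  ex_series (fun n => Rabs (Re (u n))) /\ ex_series (fun n => Rabs (Im (u n))).
Proof.
  intros HM.
  assert (Hex := ex_series_nonneg_bounded _ M (fun n => Cmod_ge_0 (u n)) HM).
  split; (eapply (ex_series_le (V := R_CompleteNormedModule)); [|exact Hex]);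
    intros n; simpl; unfold norm; simpl; unfold abs; simpl; rewrite Rabs_Rabsolu.
  - apply re_le_Cmod.
  - apply im_le_Cmod.
Qed.

Lemma CSeries_correct (u : nat -> C) (M : R) :
  (forall N, sum_f_R0 (fun n => Cmod (u n)) N <= M) -> is_Cseries u (CSeries u).
Proof.
  intros HM; destruct (ex_series_Re_Im_abs u M HM) as [HR HI].
  apply is_Cseries_parts; split; apply Series_correct; now apply ex_series_Rabs.
Qed.

Lemma is_Cseries_Cmod_le (u : nat -> C) (l : C) (M : R) :
  (forall N, sum_f_R0 (fun n => Cmod (u n)) N <= M) -> is_Cseries u l -> Cmod l <= M.
Proof.
  intros HM Hl.
  assert (H : is_lim_seq (fun N => Cmod (@sum_n C_NormedModule u N)) (Cmod l)).
  { apply (filterlim_comp _ _ _ _ _ _ _ _ Hl).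
    exact (filterlim_norm (V := C_NormedModule) l). }
  apply (is_lim_seq_le _ (fun _ => M) (Cmod l) M) in H; [exact H | | apply is_lim_seq_const].
  intros n; eapply Rle_trans; [apply Cmod_sum_n_le | apply HM].
Qed.

(** Mertens' theorem for real series, applied to the four products of real
    and imaginary parts. *)
Lemma is_Cseries_mult (u v w : nat -> C) (lu lv : C) (M N : R) :
  (forall n, sum_f_R0 (fun k => Cmod (u k)) n <= M) ->
  (forall n, sum_f_R0 (fun k => Cmod (v k)) n <= N) ->
  (forall n, w n = @sum_n C_NormedModule (fun k => (u k * v (n - k)%nat)%C) n) ->
  is_Cseries u lu -> is_Cseries v lv -> is_Cseries w (lu * lv)%C.
Proof.
  intros HM HN Hw Hu Hv.
  destruct (ex_series_Re_Im_abs u M HM) as [uR uI].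
  destruct (ex_series_Re_Im_abs v N HN) as [vR vI].
  apply is_Cseries_parts in Hu; apply is_Cseries_parts in Hv.
  destruct Hu as [HuR HuI], Hv as [HvR HvI].
  apply is_Cseries_parts; split.
  - eapply is_series_ext; [| exact (is_series_minus _ _ _ _
       (is_series_mult _ _ _ _ HuR HvR uR vR) (is_series_mult _ _ _ _ HuI HvI uI vI))].
    intros n; cbv beta; rewrite Hw, Re_sum_n, <- sum_n_Reals.
    change (plus ?x (opp ?y)) with (minus x y).
    rewrite <- sum_n_Reals; unfold minus, plus, opp; simpl.
    rewrite !sum_n_Reals.
    fold (Rminus (sum_f_R0 (fun k => Re (u k) * Re (v (n - k)%nat)) n)
                 (sum_f_R0 (fun k => Im (u k) * Im (v (n - k)%nat)) n)).
    rewrite <- minus_sum; apply sum_eq; intros k _; reflexivity.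
  - eapply is_series_ext; [| exact (is_series_plus _ _ _ _
       (is_series_mult _ _ _ _ HuR HvI uR vI) (is_series_mult _ _ _ _ HuI HvR uI vR))].
    intros n; cbv beta; rewrite Hw, Im_sum_n; unfold plus; simpl.
    rewrite sum_n_Reals, <- plus_sum; apply sum_eq; intros k _; reflexivity.
Qed.

(** * Power series with real coefficients at complex arguments *)

Definition CPSeries (a : nat -> R) (z : C) : C :=
  CSeries (fun n => (RtoC (a n) * z ^ n)%C).

Lemma sum_Cmod_CPSeries a z rho K : Cmod z <= rho -> wnorm_le rho a K ->
  forall N, sum_f_R0 (fun n => Cmod (RtoC (a n) * z ^ n)%C) N <= K.
Proof.
  intros Hz Ha N; eapply Rle_trans; [| apply (Ha N)].
  apply sum_Rle; intros n _.
  rewrite Cmod_mult, Cmod_R, Cmod_pow.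
  apply Rmult_le_compat_l; [apply Rabs_pos|].
  apply pow_incr; split; [apply Cmod_ge_0 | exact Hz].
Qed.

Lemma CPSeries_correct a z rho K : Cmod z <= rho -> wnorm_le rho a K ->
  is_Cseries (fun n => (RtoC (a n) * z ^ n)%C) (CPSeries a z).
Proof.
  intros Hz Ha; apply CSeries_correct with K.
  exact (sum_Cmod_CPSeries a z rho K Hz Ha).
Qed.

Lemma CPSeries_unique a z l :
  is_Cseries (fun n => (RtoC (a n) * z ^ n)%C) l -> CPSeries a z = l.
Proof.
  intros H; apply is_Cseries_parts in H; destruct H as [H1 H2], l as [x y].
  unfold CPSeries, CSeries; f_equal; now apply is_series_unique.
Qed.

Lemma CPSeries_ext a b z : (forall n, a n = b n) -> CPSeries a z = CPSeries b z.
Proof.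
  intros H; unfold CPSeries, CSeries; f_equal; apply Series_ext; intros n; now rewrite H.
Qed.

Lemma CPSeries_plus a b z rho K L : Cmod z <= rho ->
  wnorm_le rho a K -> wnorm_le rho b L ->
  CPSeries (PS_plus a b) z = (CPSeries a z + CPSeries b z)%C.
Proof.
  intros Hz Ha Hb; apply CPSeries_unique.
  eapply is_series_ext; [| exact (is_series_plus _ _ _ _
    (CPSeries_correct a z rho K Hz Ha) (CPSeries_correct b z rho L Hz Hb))].
  intros n; unfold PS_plus; simpl; unfold plus; simpl.
  rewrite RtoC_plus; ring.
Qed.

Lemma CPSeries_mult a b z rho K L : Cmod z <= rho ->
  wnorm_le rho a K -> wnorm_le rho b L ->
  CPSeries (PS_mult a b) z = (CPSeries a z * CPSeries b z)%C.
Proof.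
  intros Hz Ha Hb; apply CPSeries_unique.
  eapply is_Cseries_mult.
  - exact (sum_Cmod_CPSeries a z rho K Hz Ha).
  - exact (sum_Cmod_CPSeries b z rho L Hz Hb).
  - intros n; cbv beta.
    assert (H : forall m, (m <= n)%nat ->
      (RtoC (sum_f_R0 (fun k => a k * b (n - k)%nat)%R m) * z ^ n)%C =
      @sum_n C_NormedModule
        (fun k => (RtoC (a k) * z ^ k * (RtoC (b (n - k)%nat) * z ^ (n - k)))%C) m).
    { induction m as [|m IH]; intros Hm.
      - rewrite sum_O; simpl; rewrite Nat.sub_0_r, RtoC_mult; ring.
      - rewrite sum_Sn, <- IH by lia; rewrite tech5, RtoC_plus, RtoC_mult.
        assert (E : (z ^ n = z ^ S m * z ^ (n - S m))%C)
          by (rewrite <- Cpow_add_r; f_equal; lia).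
        unfold plus; simpl plus; rewrite E; simpl; ring. }
    exact (H n (le_n n)).
  - exact (CPSeries_correct a z rho K Hz Ha).
  - exact (CPSeries_correct b z rho L Hz Hb).
Qed.

Lemma Cmod_CPSeries_le a z rho K : Cmod z <= rho -> wnorm_le rho a K ->
  Cmod (CPSeries a z) <= K.
Proof.
  intros Hz Ha; eapply is_Cseries_Cmod_le.
  - exact (sum_Cmod_CPSeries a z rho K Hz Ha).
  - exact (CPSeries_correct a z rho K Hz Ha).
Qed.

(** Dividing [a - a_0] by the variable costs a factor [1 / rho]. *)
Lemma wnorm_le_tail rho a K : 0 < rho ->
  wnorm_le rho a K -> wnorm_le rho (fun n => a (S n)) (K / rho).
Proof.
  intros Hr Ha N; apply Rmult_le_reg_r with rho; [exact Hr|].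
  unfold Rdiv; rewrite Rmult_assoc, Rinv_l, Rmult_1_r by lra.
  eapply Rle_trans; [| apply (Ha (S N))].
  rewrite (decomp_sum _ (S N)) by lia; simpl pred.
  rewrite Rmult_comm, scal_sum.
  assert (H := wterm_pos rho a 0 (Rlt_le _ _ Hr)).
  match goal with |- ?x <= _ + ?y => assert (E : x = y) end.
  { apply sum_eq; intros n _; simpl; ring. }
  rewrite E; lra.
Qed.

Lemma CPSeries_decr a z rho K : 0 < rho -> Cmod z <= rho -> wnorm_le rho a K ->
  CPSeries a z = (RtoC (a 0%nat) + z * CPSeries (fun n => a (S n)) z)%C.
Proof.
  intros Hr Hz Ha; apply CPSeries_unique.
  apply (is_series_decr_1 (V := C_NormedModule)).
  eapply is_series_ext with (fun n => (z * (RtoC (a (S n)) * z ^ n))%C).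
  { intros n; simpl; ring. }
  match goal with |- @is_series _ _ _ ?l =>
    replace l with (z * CPSeries (fun n => a (S n)) z)%C end.
  2: { unfold plus, opp; simpl; unfold Copp, Cplus, Cmult; simpl;
       apply injective_projections; simpl; ring. }
  apply (is_series_scal (V := C_NormedModule)).
  apply CPSeries_correct with rho (K / rho); [exact Hz | now apply wnorm_le_tail].
Qed.

(** A factor [z] splits off for each vanishing leading coefficient, at the
    cost of a factor [1 / rho] in the norm. *)
Lemma Cmod_CPSeries_O a z rho K k : 0 < rho -> Cmod z <= rho ->
  wnorm_le rho a K -> (forall j, (j < k)%nat -> a j = 0) ->
  Cmod (CPSeries a z) <= K / rho ^ k * Cmod z ^ k.
Proof.
  revert a K; induction k as [|k IH]; intros a K Hr Hz Ha H0.
  - simpl; replace (K / 1 * 1) with K by field.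
    exact (Cmod_CPSeries_le a z rho K Hz Ha).
  - rewrite (CPSeries_decr a z rho K Hr Hz Ha), H0 by lia.
    rewrite Cplus_0_l, Cmod_mult.
    assert (H := IH (fun n => a (S n)) (K / rho) Hr Hz (wnorm_le_tail rho a K Hr Ha)
                   (fun j Hj => H0 (S j) (proj1 (Nat.succ_lt_mono j k) Hj))).
    assert (Hk : 0 < rho ^ k) by now apply pow_lt.
    simpl; replace (K / (rho * rho ^ k) * (Cmod z * Cmod z ^ k))
      with (Cmod z * (K / rho / rho ^ k * Cmod z ^ k)) by (field; lra).
    apply Rmult_le_compat_l; [apply Cmod_ge_0 | exact H].
Qed.

Lemma is_series_zero : is_series (fun _ : nat => 0) 0.
Proof.
  apply filterlim_ext with (fun _ => 0); [| apply filterlim_const].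
  intros n; rewrite sum_n_Reals, sum_cte; ring.
Qed.

Lemma CPSeries_real a x : Im (CPSeries a (RtoC x)) = 0.
Proof.
  change (Series (fun n => Im (RtoC (a n) * RtoC x ^ n)%C) = 0).
  apply is_series_unique.
  apply is_series_ext with (fun _ => 0).
  - intros n; rewrite <- RtoC_pow, <- RtoC_mult; reflexivity.
  - exact is_series_zero.
Qed.

Definition quad_coef (q0 q1 q2 : R) (n : nat) : R :=
  match n with 0 => q0 | 1 => q1 | 2 => q2 | _ => 0 end.

Lemma wnorm_le_quad_coef q0 q1 q2 rho : 0 <= rho <= 1 ->
  wnorm_le rho (quad_coef q0 q1 q2) (Rabs q0 + Rabs q1 + Rabs q2).
Proof.
  intros Hr; apply wnorm_le_shrink; [exact Hr|]; intros N.
  assert (H0 := Rabs_pos q0); assert (H1 := Rabs_pos q1); assert (H2 := Rabs_pos q2).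
  destruct N as [|[|N]]; simpl; try lra.
  induction N as [|N IH]; simpl in *; [lra|].
  rewrite Rabs_R0; lra.
Qed.

Lemma CPSeries_quad_coef q0 q1 q2 z : Cmod z <= 1 ->
  CPSeries (quad_coef q0 q1 q2) z = (RtoC q0 + RtoC q1 * z + RtoC q2 * z ^ 2)%C.
Proof.
  intros Hz.
  assert (H := wnorm_le_quad_coef q0 q1 q2 1 ltac:(lra)).
  assert (H' := wnorm_le_tail _ _ _ Rlt_0_1 H).
  assert (H'' := wnorm_le_tail _ _ _ Rlt_0_1 H').
  rewrite (CPSeries_decr _ _ _ _ Rlt_0_1 Hz H),
    (CPSeries_decr _ _ _ _ Rlt_0_1 Hz H'), (CPSeries_decr _ _ _ _ Rlt_0_1 Hz H'').
  replace (CPSeries _ z) with (RtoC 0); [simpl; ring|].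
  symmetry; apply Cmod_eq_0, Rle_antisym; [| apply Cmod_ge_0].
  apply Cmod_CPSeries_le with 1; [exact Hz|].
  exact (wnorm_le_0 1 0 (Rle_refl 0)).
Qed.

(** * Complex differentiability *)

(** A quadratic remainder bound sums over the terms of a series, which an
    [o(w - z)] for each term would not. *)
Lemma is_derive_of_quadratic (f : C -> C) (z l : C) (M delta : R) :
  0 < delta ->
  (forall w : C, Cmod (w - z) < delta ->
     Cmod (f w - f z - (w - z) * l) <= M * Cmod (w - z) ^ 2) ->
  @is_derive C_AbsRing C_NormedModule f z l.
Proof.
  intros Hd H; split; [apply is_linear_scal_l|].
  intros x Hx; apply (is_filter_lim_locally_unique (K := C_AbsRing)
    (V := AbsRing_NormedModule C_AbsRing)) in Hx; subst x.
  intros eps.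
  assert (HM : 0 < Rabs M + 1) by (generalize (Rabs_pos M); lra).
  assert (Hpos : 0 < Rmin delta (eps / (Rabs M + 1))).
  { apply Rmin_pos; [exact Hd|]; apply Rdiv_lt_0_compat; [apply cond_pos | exact HM]. }
  exists (mkposreal _ Hpos); intros w Hw.
  change (Cmod (w - z) < Rmin delta (eps / (Rabs M + 1))) in Hw.
  change (Cmod (f w - f z - (w - z) * l) <= eps * Cmod (w - z)).
  assert (Hw1 := Rlt_le_trans _ _ _ Hw (Rmin_l _ _)).
  assert (Hw2 := Rlt_le_trans _ _ _ Hw (Rmin_r _ _)).
  eapply Rle_trans; [apply (H w Hw1)|].
  assert (Hc := Cmod_ge_0 (w - z)).
  assert (Cmod (w - z) * (Rabs M + 1) <= eps).
  { apply Rmult_lt_compat_r with (r := Rabs M + 1) in Hw2; [|exact HM].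
    unfold Rdiv in Hw2; rewrite Rmult_assoc, Rinv_l, Rmult_1_r in Hw2; lra. }
  assert (HMa := Rle_abs M).
  simpl; nra.
Qed.

Lemma ex_derive_Cinv (z : C) : z <> RtoC 0 ->
  @ex_derive C_AbsRing C_NormedModule Cinv z.
Proof.
  intros Hz; assert (Hm := proj1 (Cmod_gt_0 z) Hz).
  exists (- / z ^ 2)%C.
  apply is_derive_of_quadratic with (M := 2 / Cmod z ^ 3) (delta := Cmod z / 2); [lra|].
  intros w Hw.
  assert (Hw2 : Cmod z / 2 <= Cmod w).
  { assert (Ht := Cmod_triangle w (- (w - z))%C).
    rewrite Cmod_opp in Ht; replace (w + - (w - z))%C with z in Ht by ring; lra. }
  assert (Hw0 : w <> RtoC 0) by (apply Cmod_gt_0; lra).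
  (* The remainder of [1/w] is exactly [h^2 / (z^2 w)], with [|w| >= |z|/2]. *)
  replace (/ w - / z - (w - z) * - / z ^ 2)%C with ((w - z) ^ 2 / (z ^ 2 * w))%C
    by (field; auto).
  rewrite Cmod_div, Cmod_mult, !Cmod_pow
    by (apply Cmult_neq_0; [now apply Cpow_nz | exact Hw0]).
  unfold Rdiv at 1; rewrite Rmult_comm; apply Rmult_le_compat_r; [apply pow2_ge_0|].
  replace (2 / Cmod z ^ 3) with (/ (Cmod z ^ 2 * (Cmod z / 2))) by (field; lra).
  assert (0 < Cmod z ^ 2) by now apply pow_lt.
  apply Rinv_le_contravar; [apply Rmult_lt_0_compat; lra|].
  apply Rmult_le_compat_l; lra.
Qed.

(** Bernoulli's inequality in homogeneous form: a factor [n] is paid for by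
    enlarging the radius. *)
Lemma INR_pow_pred_le r rho n : 0 <= r <= rho ->
  INR n * r ^ pred n * (rho - r) <= rho ^ n.
Proof.
  intros Hr; induction n as [|n IH]; [simpl; lra|].
  assert (Hp : r ^ n <= rho ^ n) by (apply pow_incr; lra).
  assert (E : INR n * r ^ n = r * (INR n * r ^ pred n)) by (destruct n; simpl; ring).
  rewrite S_INR; simpl pred; rewrite Rmult_plus_distr_r, E; simpl; nra.
Qed.

(** With [E_n] the remainder and [h = w - z] one has
    [E_(n+1) = w E_n + n z^(n-1) h^2].  Splitting [rho = r + (rho - r)], the
    first term is covered by induction and the second by [INR_pow_pred_le]. *)
Lemma Cpow_taylor_remainder (z w : C) r rho n :
  0 <= r <= rho -> Cmod z <= r -> Cmod w <= r ->
  Cmod (w ^ n - z ^ n - (w - z) * (RtoC (INR n) * z ^ pred n)) * (rho - r) ^ 2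
  <= rho ^ n * Cmod (w - z) ^ 2.
Proof.
  intros Hr Hz Hw; induction n as [|n IH].
  - replace (w ^ 0 - z ^ 0 - (w - z) * (RtoC (INR 0) * z ^ pred 0))%C with (RtoC 0)
      by (simpl; ring).
    rewrite Cmod_0, Rmult_0_l; simpl; generalize (pow2_ge_0 (Cmod (w - z))); simpl; lra.
  - set (E := (w ^ n - z ^ n - (w - z) * (RtoC (INR n) * z ^ pred n))%C) in *.
    replace (w ^ S n - z ^ S n - (w - z) * (RtoC (INR (S n)) * z ^ pred (S n)))%C
      with (w * E + RtoC (INR n) * z ^ pred n * (w - z) ^ 2)%C.
    2: { unfold E; rewrite S_INR, RtoC_plus; destruct n; simpl; ring. }
    assert (Hh := pow2_ge_0 (Cmod (w - z))).
    assert (Hn := pos_INR n).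
    assert (Hb : INR n * r ^ pred n * (rho - r) <= rho ^ n) by now apply INR_pow_pred_le.
    assert (H1 : Cmod (w * E) * (rho - r) ^ 2 <= r * (rho ^ n * Cmod (w - z) ^ 2)).
    { rewrite Cmod_mult, Rmult_assoc; apply Rmult_le_compat; try assumption.
      - apply Cmod_ge_0.
      - apply Rmult_le_pos; [apply Cmod_ge_0 | apply pow2_ge_0]. }
    assert (H2 : Cmod (RtoC (INR n) * z ^ pred n * (w - z) ^ 2) * (rho - r) ^ 2
                 <= (rho - r) * (rho ^ n * Cmod (w - z) ^ 2)).
    { rewrite !Cmod_mult, Cmod_R, !Cmod_pow, Rabs_right by lra.
      assert (Hp : Cmod z ^ pred n <= r ^ pred n)
        by (apply pow_incr; split; [apply Cmod_ge_0 | exact Hz]).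
      assert (Hq : INR n * Cmod z ^ pred n * (rho - r) <= rho ^ n).
      { eapply Rle_trans; [|exact Hb]; apply Rmult_le_compat_r; [lra|].
        now apply Rmult_le_compat_l. }
      replace (INR n * Cmod z ^ pred n * Cmod (w - z) ^ 2 * (rho - r) ^ 2)
        with ((rho - r) * (INR n * Cmod z ^ pred n * (rho - r) * Cmod (w - z) ^ 2)) by ring.
      apply Rmult_le_compat_l; [lra|]; now apply Rmult_le_compat_r. }
    eapply Rle_trans.
    { apply Rmult_le_compat_r; [apply pow2_ge_0 | apply Cmod_triangle]. }
    rewrite Rmult_plus_distr_r.
    replace (rho ^ S n * Cmod (w - z) ^ 2)
      with (r * (rho ^ n * Cmod (w - z) ^ 2)
            + (rho - r) * (rho ^ n * Cmod (w - z) ^ 2)) by (simpl; ring).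
    now apply Rplus_le_compat.
Qed.

(** Summing the termwise remainders against [|a_n|] gives
    [K |w - z|^2 / (rho - r)^2] for any [r] between [|z|] and [rho]. *)
Lemma ex_derive_CPSeries a z rho K : Cmod z < rho -> wnorm_le rho a K ->
  @ex_derive C_AbsRing C_NormedModule (CPSeries a) z.
Proof.
  intros Hz Ha; assert (Hz0 := Cmod_ge_0 z).
  set (r := (Cmod z + rho) / 2).
  assert (Hr : Cmod z <= r < rho) by (unfold r; lra).
  set (u := fun n => (RtoC (a n) * (RtoC (INR n) * z ^ pred n))%C).
  assert (Hu : forall N, sum_f_R0 (fun n => Cmod (u n)) N <= K / (rho - r)).
  { intros N; apply Rmult_le_reg_r with (rho - r); [lra|].
    unfold Rdiv; rewrite Rmult_assoc, Rinv_l, Rmult_1_r by lra.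
    eapply Rle_trans; [| apply (Ha N)].
    rewrite Rmult_comm, scal_sum; apply sum_Rle; intros n _.
    unfold u; rewrite !Cmod_mult, !Cmod_R, Cmod_pow, Rmult_assoc.
    rewrite (Rabs_right (INR n)) by (apply Rle_ge, pos_INR).
    apply Rmult_le_compat_l; [apply Rabs_pos|].
    eapply Rle_trans; [| apply (INR_pow_pred_le r rho n); lra].
    apply Rmult_le_compat_r; [lra|]; apply Rmult_le_compat_l; [apply pos_INR|].
    apply pow_incr; lra. }
  exists (CSeries u).
  apply is_derive_of_quadratic with (M := K / (rho - r) ^ 2) (delta := r - Cmod z);
    [unfold r; lra|].
  intros w Hwz.
  assert (Hw : Cmod w <= r).
  { assert (Ht := Cmod_triangle z (w - z)%C).
    replace (z + (w - z))%C with w in Ht by ring; lra. }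
  assert (Hser : is_Cseries
    (fun n => (RtoC (a n) * w ^ n - RtoC (a n) * z ^ n - (w - z) * u n)%C)
    (CPSeries a w - CPSeries a z - (w - z) * CSeries u)%C).
  { apply (is_series_minus (V := C_NormedModule)).
    - apply (is_series_minus (V := C_NormedModule)).
      + apply CPSeries_correct with rho K; [lra | exact Ha].
      + apply CPSeries_correct with rho K; [lra | exact Ha].
    - apply (is_series_scal (V := C_NormedModule)).
      exact (CSeries_correct u _ Hu). }
  apply (fun HM => is_Cseries_Cmod_le _ _ _ HM Hser).
  intros N.
  assert (Hq : 0 < (rho - r) ^ 2) by (apply pow_lt; lra).
  apply Rmult_le_reg_r with ((rho - r) ^ 2); [exact Hq|].
  replace (K / (rho - r) ^ 2 * Cmod (w - z) ^ 2 * (rho - r) ^ 2)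
    with (Cmod (w - z) ^ 2 * K) by (field; lra).
  eapply Rle_trans;
    [| apply Rmult_le_compat_l; [apply pow2_ge_0 | apply (Ha N)]].
  rewrite Rmult_comm, !scal_sum; apply sum_Rle; intros n _.
  replace (RtoC (a n) * w ^ n - RtoC (a n) * z ^ n - (w - z) * u n)%C
    with (RtoC (a n) * (w ^ n - z ^ n - (w - z) * (RtoC (INR n) * z ^ pred n)))%C
    by (unfold u; ring).
  rewrite Cmod_mult, Cmod_R, !Rmult_assoc.
  apply Rmult_le_compat_l; [apply Rabs_pos|].
  apply Cpow_taylor_remainder; lra.
Qed.

(** * Series with a simple pole *)

Definition polar_series (s : R) (b : nat -> R) (z : C) : C :=
  (RtoC s * / z + CPSeries b z)%C.

Definition polar_coef (s : R) (b : nat -> R) (n : Z) : C :=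
  match n with
  | Zneg 1 => RtoC s
  | Zneg _ => RtoC 0
  | _ => RtoC (b (Z.to_nat n))
  end.

Lemma polar_series_holomorphic s b rho K : wnorm_le rho b K ->
  holomorphic_on (punctured_ball rho) (polar_series s b).
Proof.
  intros Hb z [Hz0 Hz].
  apply (ex_derive_plus (V := C_NormedModule) (fun z => (RtoC s * / z)%C)).
  - destruct (ex_derive_Cinv z) as [l Hl]; [now apply Cmod_gt_0|].
    exists (RtoC s * l)%C.
    eapply filterdiff_ext_lin;
      [exact (filterdiff_scal_r_fct (RtoC s) _ _ Cmult_comm Hl)|].
    intros y; change (RtoC s * (y * l) = y * (RtoC s * l))%C; ring.
  - now apply ex_derive_CPSeries with rho K.
Qed.

Lemma polar_series_laurent s b rho K : wnorm_le rho b K ->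
  laurent_expansion rho (polar_series s b) (polar_coef s b).
Proof.
  intros Hb z [Hz0 Hz].
  exists (CPSeries b z), (RtoC s * / z)%C; split; [|split].
  - eapply is_series_ext; [| exact (CPSeries_correct b z rho K (Rlt_le _ _ Hz) Hb)].
    intros n; cbv beta; f_equal.
    destruct n as [|n]; [reflexivity|].
    rewrite <- (Nat2Z.id (S n)) at 1; reflexivity.
  - apply (is_series_decr_1 (V := C_NormedModule)).
    eapply is_series_ext with (fun _ => RtoC 0).
    { intros n.
      replace (polar_coef s b (- Z.of_nat (S (S n)))) with (RtoC 0)
        by (simpl; destruct (Pos.of_succ_nat n); reflexivity).
      symmetry; apply Cmult_0_l. }
    match goal with |- @is_series _ _ _ ?l => replace l with (RtoC 0) end.
    2: { unfold plus, opp; simpl; rewrite Cmult_1_r; symmetry; apply Cplus_opp_r. }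
    apply is_Cseries_parts; split; apply is_series_zero.
  - unfold polar_series; apply Cplus_comm.
Qed.

Lemma Re_CPSeries_bounds b x rho K : 0 <= x <= rho -> wnorm_le rho b K ->
  - K <= Re (CPSeries b (RtoC x)) <= K.
Proof.
  intros Hx Hb; apply Rabs_le_between.
  eapply Rle_trans; [apply re_le_Cmod|].
  apply Cmod_CPSeries_le with rho; [| exact Hb].
  rewrite Cmod_R, Rabs_right; lra.
Qed.

Lemma polar_series_real s b x : 0 < x -> Im (polar_series s b (RtoC x)) = 0.
Proof.
  intros Hx; unfold polar_series.
  rewrite <- RtoC_inv by lra; rewrite <- RtoC_mult.
  change (0 + Im (CPSeries b (RtoC x)) = 0); rewrite CPSeries_real; ring.
Qed.

Lemma Re_polar_series s b x : 0 < x ->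
  Re (polar_series s b (RtoC x)) = s / x + Re (CPSeries b (RtoC x)).
Proof.
  intros Hx; unfold polar_series.
  rewrite <- RtoC_inv by lra; rewrite <- RtoC_mult; reflexivity.
Qed.

(** The gap [(t - s) / x] between the polar parts exceeds twice the bound on
    the regular parts. *)
Lemma polar_series_lt s t b c x rho K : 0 < x < rho -> 2 * K * rho < t - s ->
  wnorm_le rho b K -> wnorm_le rho c K ->
  Re (polar_series s b (RtoC x)) < Re (polar_series t c (RtoC x)).
Proof.
  intros Hx Hst Hb Hc; rewrite !Re_polar_series by lra.
  assert (H1 := Re_CPSeries_bounds b x rho K ltac:(lra) Hb).
  assert (H2 := Re_CPSeries_bounds c x rho K ltac:(lra) Hc).
  assert (H : 2 * K < (t - s) / x).
  { apply Rmult_lt_reg_r with x; [lra|].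
    replace ((t - s) / x * x) with (t - s) by (field; lra); nra. }
  unfold Rdiv in *; lra.
Qed.

(** The error is the regular part without its constant term, a power series
    vanishing to order [k]. *)
Lemma polar_series_bigO s b rho K k : 0 < rho -> wnorm_le rho b K ->
  (forall j, (0 < j < k)%nat -> b j = 0) ->
  bigO_pow k (fun z => polar_series s b z - (RtoC s * / z + RtoC (b 0%nat)))%C.
Proof.
  intros Hr Hb H0.
  set (b' := fun n => match n with O => 0 | S _ => b n end).
  assert (Hb' : wnorm_le rho b' K).
  { intros N; eapply Rle_trans; [| apply (Hb N)].
    apply sum_Rle; intros [|n] _; [|apply Rle_refl].
    simpl; rewrite Rabs_R0; generalize (Rabs_pos (b 0%nat)); lra. }
  exists (K / rho ^ k), rho; split; [exact Hr|]; intros z [Hz0 Hz].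
  replace (polar_series s b z - (RtoC s * / z + RtoC (b 0%nat)))%C with (CPSeries b' z).
  - apply Cmod_CPSeries_O; [exact Hr | lra | exact Hb'|].
    intros [|j] Hj; [reflexivity | apply H0; lia].
  - unfold polar_series.
    rewrite (CPSeries_decr b z rho K), (CPSeries_decr b' z rho K) by (assumption || lra).
    simpl b'; ring.
Qed.

(** * The branches of the cubic *)

Lemma cubic_fix_CPSeries c0 c1 c2 c3 K z : c0 0%nat = 0 -> c1 0%nat = 0 -> 1 <= K ->
  wnorm_le 1 c0 K -> wnorm_le 1 c1 K -> wnorm_le 1 c2 K -> wnorm_le 1 c3 K ->
  Cmod z <= / (16 * K ^ 2) ->
  let v := CPSeries (cubic_fix c0 c1 c2 c3) z in
  v = (CPSeries c0 z + v * (CPSeries c1 z + v * (CPSeries c2 z + v * CPSeries c3 z)))%C.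
Proof.
  intros h0 h1 HK H0 H1 H2 H3 Hz v.
  set (rho := / (16 * K ^ 2)) in *; set (eta := / (4 * K)).
  assert (Hrho : 0 <= rho <= 1).
  { assert (1 <= K ^ 2) by nra.
    split; [apply Rlt_le, Rinv_0_lt_compat; lra|].
    rewrite <- Rinv_1; apply Rinv_le_contravar; lra. }
  assert (Heta : 0 <= eta) by (apply Rlt_le, Rinv_0_lt_compat; lra).
  assert (HeK : 0 <= eta * K) by (apply Rmult_le_pos; lra).
  assert (HeeK : 0 <= eta * (eta * K)) by now apply Rmult_le_pos.
  assert (Ha : wnorm_le rho (cubic_fix c0 c1 c2 c3) eta) by now apply cubic_fix_wnorm.
  assert (G0 := wnorm_le_shrink rho c0 K Hrho H0).
  assert (G1 := wnorm_le_shrink rho c1 K Hrho H1).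
  assert (G2 := wnorm_le_shrink rho c2 K Hrho H2).
  assert (G3 := wnorm_le_shrink rho c3 K Hrho H3).
  assert (M3 := wnorm_le_mult rho _ _ eta K (proj1 Hrho) ltac:(lra) Ha G3).
  assert (S2 := wnorm_le_plus rho _ _ _ _ (proj1 Hrho) G2 M3).
  assert (M2 := wnorm_le_mult rho _ _ eta (K + eta * K) (proj1 Hrho) ltac:(lra) Ha S2).
  assert (S1 := wnorm_le_plus rho _ _ _ _ (proj1 Hrho) G1 M2).
  assert (M1 := wnorm_le_mult rho _ _ eta (K + eta * (K + eta * K)) (proj1 Hrho)
                  ltac:(rewrite Rmult_plus_distr_l; lra) Ha S1).
  unfold v at 1.
  rewrite (CPSeries_ext _ (cubic_step c0 c1 c2 c3 (cubic_fix c0 c1 c2 c3)))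
    by (intros n; now apply cubic_fix_eq).
  unfold cubic_step.
  rewrite (CPSeries_plus _ _ z rho _ _ Hz G0 M1), (CPSeries_mult _ _ z rho _ _ Hz Ha S1),
    (CPSeries_plus _ _ z rho _ _ Hz G1 M2), (CPSeries_mult _ _ z rho _ _ Hz Ha S2),
    (CPSeries_plus _ _ z rho _ _ Hz G2 M3), (CPSeries_mult _ _ z rho _ _ Hz Ha G3).
  reflexivity.
Qed.

(** The hypothesis on [s] says that it is a root of the limit equation
    [3 w = w^3]; all of them are simple, which makes [3 - 3 s^2] invertible.
    The fixed-point coefficients are bounded by [K = 3], whence the radius
    [1/144 = 1/(16 K^2)] and the bound [12 = (1/(4 K)) / (1/144)] for
    [v / eps]. *)
Lemma cubic_branch (alpha s : R) : 0 < alpha < 1 / 2 -> s ^ 3 = 3 * s ->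
  exists b : nat -> R,
    wnorm_le (/ 144) b 12 /\ b 0%nat = (1 + alpha) / 3 /\ (s = 0 -> b 1%nat = 0) /\
    forall eps : C, punctured_ball (/ 144) eps ->
      f_cubic alpha eps (polar_series s b eps) = RtoC 0.
Proof.
  intros Ha Hs.
  set (e := / (3 - 3 * s ^ 2)).
  assert (Hcase : s = 0 \/ s ^ 2 = 3).
  { destruct (Req_dec s 0) as [H|H]; [now left | right; nra]. }
  assert (Hd : (3 - 3 * s ^ 2) * e = 1)
    by (apply Rinv_r; destruct Hcase as [->| ->]; lra).
  assert (Hsb : Rabs s <= 9 / 5).
  { apply Rabs_le; destruct Hcase as [->|H]; [lra | nra]. }
  assert (Heb : Rabs e <= 1 / 3).
  { apply Rabs_le; destruct Hcase as [H|H]; rewrite H in Hd; lra. }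
  assert (Hse : Rabs (s * e) <= 3 / 5).
  { rewrite Rabs_mult; generalize (Rabs_pos s), (Rabs_pos e); nra. }
  assert (Hc01 : (1 - s ^ 2) * (1 + alpha) * e = (1 + alpha) / 3) by nra.
  (* Coefficients of
     [v = e ((1+alpha) eps (1 - w^2) + alpha eps^2 w + 3 s v^2 + v^3)]
     at [w = s + v], ordered by powers of [v]. *)
  set (c0 := quad_coef 0 ((1 - s ^ 2) * (1 + alpha) * e) (alpha * (s * e))).
  set (c1 := quad_coef 0 (- 2 * (1 + alpha) * (s * e)) (alpha * e)).
  set (c2 := quad_coef (3 * (s * e)) (- (1 + alpha) * e) 0).
  set (c3 := quad_coef e 0 0).
  assert (H0 : wnorm_le 1 c0 3).
  { intros N; eapply Rle_trans; [apply wnorm_le_quad_coef; lra|].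
    rewrite Hc01, Rabs_R0, Rabs_right, Rabs_mult, (Rabs_right alpha) by lra; nra. }
  assert (H1 : wnorm_le 1 c1 3).
  { intros N; eapply Rle_trans; [apply wnorm_le_quad_coef; lra|].
    rewrite Rabs_R0, !Rabs_mult, (Rabs_right alpha), (Rabs_right (1 + alpha)),
      (Rabs_left (-2)) by lra.
    rewrite Rabs_mult in Hse; nra. }
  assert (H2 : wnorm_le 1 c2 3).
  { intros N; eapply Rle_trans; [apply wnorm_le_quad_coef; lra|].
    rewrite Rabs_R0, !Rabs_mult, Rabs_Ropp, (Rabs_right 3), (Rabs_right (1 + alpha)) by lra.
    rewrite Rabs_mult in Hse; generalize (Rabs_pos e); nra. }
  assert (H3 : wnorm_le 1 c3 3).
  { intros N; eapply Rle_trans; [apply wnorm_le_quad_coef; lra|].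
    rewrite Rabs_R0; lra. }
  set (a := cubic_fix c0 c1 c2 c3).
  assert (Haw : wnorm_le (/ 144) a (/ 12)).
  { replace (/ 144) with (/ (16 * 3 ^ 2)) by (f_equal; ring).
    replace (/ 12) with (/ (4 * 3)) by (f_equal; ring).
    apply cubic_fix_wnorm; auto; lra. }
  assert (Ha0 : a 0%nat = 0) by reflexivity.
  assert (Ha1 : a 1%nat = (1 + alpha) / 3).
  { rewrite <- Hc01; unfold a; rewrite cubic_fix_eq by reflexivity; fold a.
    unfold cubic_step, PS_plus, PS_mult, plus; simpl; unfold plus; simpl.
    rewrite Ha0; ring. }
  exists (fun n => a (S n)); split; [|split; [exact Ha1|split]].
  - replace 12 with (/ 12 / / 144) by field; apply wnorm_le_tail; [lra | exact Haw].
  - intros ->; unfold a; rewrite cubic_fix_eq by reflexivity; fold a.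
    unfold cubic_step, PS_plus, PS_mult, plus; simpl; unfold plus; simpl.
    rewrite Ha0; ring.
  - intros eps [Heps0 Heps].
    assert (Hne : eps <> RtoC 0) by now apply Cmod_gt_0.
    assert (Hv := cubic_fix_CPSeries c0 c1 c2 c3 3 eps eq_refl eq_refl ltac:(lra)
                    H0 H1 H2 H3).
    replace (/ (16 * 3 ^ 2)) with (/ 144) in Hv by (f_equal; ring).
    specialize (Hv (Rlt_le _ _ Heps)); cbv zeta in Hv; fold a in Hv.
    unfold c0, c1, c2, c3 in Hv; rewrite !CPSeries_quad_coef in Hv by lra.
    assert (Hav := CPSeries_decr a eps (/ 144) (/ 12) ltac:(lra) (Rlt_le _ _ Heps) Haw).
    rewrite Ha0, Cplus_0_l in Hav; rewrite Hav in Hv.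
    unfold polar_series.
    set (b := CPSeries (fun n => a (S n)) eps) in *.
    assert (HdC : ((3 - 3 * RtoC s ^ 2) * RtoC e = 1)%C).
    { rewrite <- RtoC_pow, <- RtoC_mult, <- RtoC_minus, <- RtoC_mult; now f_equal. }
    assert (HsC : (RtoC s ^ 3 = 3 * RtoC s)%C).
    { rewrite <- RtoC_pow, <- RtoC_mult; now f_equal. }
    rewrite !RtoC_mult, !RtoC_opp, RtoC_minus, RtoC_pow, RtoC_plus in Hv.
    set (S := RtoC s) in *; set (E := RtoC e) in *; set (A := RtoC alpha) in *.
    set (v := (eps * b)%C) in *.
    set (Q := ((1 + A) * eps * (1 - S ^ 2) + A * S * eps ^ 2
               + v * (- 2 * (1 + A) * S * eps + A * eps ^ 2
               + v * (3 * S - (1 + A) * eps + v)))%C).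
    assert (HvE : v = (E * Q)%C) by (rewrite Hv at 1; unfold Q; ring).
    assert (HQ : ((3 - 3 * S ^ 2) * v = Q)%C).
    { rewrite HvE, Cmult_assoc, HdC; ring. }
    replace (S * / eps + b)%C with ((S + v) * / eps)%C by (unfold v; field; exact Hne).
    unfold f_cubic; fold A.
    (* After multiplication by [eps^3] the cubic is the fixed-point equation
       times [3 - 3 s^2], up to the defect [3 s - s^3]. *)
    transitivity (((3 - 3 * S ^ 2) * v - Q + (3 * S - S ^ 3)) * / eps ^ 3)%C.
    + unfold Q; field; exact Hne.
    + rewrite HQ, HsC; ring.
Qed.

Theorem lemma2p1 (alpha : R) (Halpha : 0 < alpha < 1 / 2) :
  exists (eps0 : R) (zm z0 zp : C -> C),
    0 < eps0 /\
    holomorphic_on (punctured_ball eps0) zm /\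
    holomorphic_on (punctured_ball eps0) z0 /\
    holomorphic_on (punctured_ball eps0) zp /\
    (forall eps : C, punctured_ball eps0 eps ->
       f_cubic alpha eps (zm eps) = RtoC 0 /\
       f_cubic alpha eps (z0 eps) = RtoC 0 /\
       f_cubic alpha eps (zp eps) = RtoC 0) /\
    (forall x : R, 0 < x -> punctured_ball eps0 (RtoC x) ->
       Im (zm (RtoC x)) = 0 /\ Im (z0 (RtoC x)) = 0 /\ Im (zp (RtoC x)) = 0 /\
       Re (zm (RtoC x)) < Re (z0 (RtoC x)) < Re (zp (RtoC x))) /\
    (exists cm c0 cp : Z -> C,
       laurent_expansion eps0 zm cm /\
       laurent_expansion eps0 z0 c0 /\
       laurent_expansion eps0 zp cp /\
       (forall n : Z, (n < 0)%Z -> c0 n = RtoC 0) /\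
       c0 0%Z = RtoC ((1 + alpha) / 3) /\
       c0 1%Z = RtoC 0 /\
       (forall n : Z, (n < -1)%Z -> cm n = RtoC 0 /\ cp n = RtoC 0) /\
       cm (-1)%Z = RtoC (- sqrt 3) /\
       cp (-1)%Z = RtoC (sqrt 3) /\
       cm 0%Z = RtoC ((1 + alpha) / 3) /\
       cp 0%Z = RtoC ((1 + alpha) / 3)) /\
    bigO_pow 2 (fun eps : C => z0 eps - RtoC ((1 + alpha) / 3))%C /\
    bigO_pow 1 (fun eps : C =>
      zm eps - (- RtoC (sqrt 3) * / eps + RtoC ((1 + alpha) / 3)))%C /\
    bigO_pow 1 (fun eps : C =>
      zp eps - (RtoC (sqrt 3) * / eps + RtoC ((1 + alpha) / 3)))%C.
Proof.
  assert (H3 : sqrt 3 ^ 2 = 3) by (apply pow2_sqrt; lra).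
  assert (H3p : 1 < sqrt 3) by (rewrite <- sqrt_1; apply sqrt_lt_1; lra).
  destruct (cubic_branch alpha (- sqrt 3) Halpha ltac:(simpl in *; nra))
    as (bm & Wm & bm0 & _ & Rm).
  destruct (cubic_branch alpha 0 Halpha ltac:(simpl; ring)) as (b0 & W0 & b00 & b01 & R0).
  destruct (cubic_branch alpha (sqrt 3) Halpha ltac:(simpl in *; nra))
    as (bp & Wp & bp0 & _ & Rp).
  specialize (b01 eq_refl).
  exists (/ 144), (polar_series (- sqrt 3) bm), (polar_series 0 b0),
    (polar_series (sqrt 3) bp).
  split; [lra|].
  split; [now apply polar_series_holomorphic with 12|].
  split; [now apply polar_series_holomorphic with 12|].
  split; [now apply polar_series_holomorphic with 12|].
  split; [now intros eps Heps; auto|].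
  split.
  { intros x Hx [_ Hx']; rewrite Cmod_R, Rabs_right in Hx' by lra.
    do 3 (split; [now apply polar_series_real|]).
    split; apply polar_series_lt with (/ 144) 12; (assumption || lra). }
  split.
  { exists (polar_coef (- sqrt 3) bm), (polar_coef 0 b0), (polar_coef (sqrt 3) bp).
    do 3 (split; [now apply polar_series_laurent with 12|]).
    split; [intros [|p|[p|p|]] Hn; (reflexivity || lia)|].
    split; [now rewrite <- b00|].
    split; [now rewrite <- b01|].
    split; [intros [|p|[p|p|]] Hn; (split; reflexivity) || lia|].
    do 2 (split; [reflexivity|]).
    split; [now rewrite <- bm0 | now rewrite <- bp0]. }
  assert (Bm := polar_series_bigO (- sqrt 3) bm (/ 144) 12 1 ltac:(lra) Wm ltac:(lia)).
  assert (B0 := polar_series_bigO 0 b0 (/ 144) 12 2 ltac:(lra) W0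
    ltac:(intros j Hj; now replace j with 1%nat by lia)).
  assert (Bp := polar_series_bigO (sqrt 3) bp (/ 144) 12 1 ltac:(lra) Wp ltac:(lia)).
  rewrite bm0, RtoC_opp in Bm; rewrite bp0 in Bp; rewrite b00 in B0.
  split; [| now split].
  destruct B0 as (M & delta & Hdelta & HM); exists M, delta; split; [exact Hdelta|].
  intros eps Heps; specialize (HM eps Heps); now rewrite Cmult_0_l, Cplus_0_l in HM.
Qed.
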